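(* Let $k$ be a field, $R=k[x,y,z]$, and fix an integer $n\ge 4$. Let $J$ be a grade $3$ homogeneous ideal of $R$ with graded Betti numbers $\beta_{1,2}=1$, $\beta_{1,n+1}=2$, $\beta_{1,n+3}=1$, $\beta_{1,2n+4}=1$, $\beta_{2,n+2}=2$, $\beta_{2,n+4}=1$, $\beta_{2,2n+3}=1$, $\beta_{2,2n+6}=2$, $\beta_{2,3n+4}=1$, $\beta_{3,2n+4}=\beta_{3,2n+7}=\beta_{3,3n+5}=1$, and $\beta_{i,j}(R/J)=0$ for all other $i\ge1$ and all $j$. Consider the monomial ideal \[J'=(x^2,\ y^{2n+1},\ z^{2n+4},\ y^nz,\ xy^{n-1}z,\ xyz^{n+1}).\] Then $J'$ is sequentially bounded licci and $R/J'$ has the same Hilbert function as $R/J$.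
   Context: $R$ has the standard grading; $\beta_{i,j}(R/J)=\dim_k\operatorname{Tor}_i^R(R/J,k)_j$. A homogeneous complete intersection of grade $g$ is an ideal generated by a regular sequence of homogeneous forms $f_1,\dots,f_g$ with $\deg f_1\le\dots\le\deg f_g$; its type is $(\deg f_1,\dots,\deg f_g)$, and types are compared componentwise. Homogeneous ideals $I,I'$ of grade $g$ are directly linked by a homogeneous complete intersection $C$ of grade $g$ if $I=C:I'$ and $I'=C:I$. A homogeneous perfect ideal $I$ is sequentially bounded licci (SBL) if there is a finite sequence of direct links $I=I_0\sim_{C_0}I_1\sim\cdots\sim_{C_{s-1}}I_s$ with each $C_i$ a homogeneous complete intersection, $I_s$ a complete intersection, and $\operatorname{type}(C_i)\ge\operatorname{type}(C_{i+1})$ componentwise for all $i$. *)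

(* Defs.v *)
From mathcomp Require Import all_boot all_algebra.
From mathcomp Require Export mpoly.

Set Implicit Arguments.
Unset Strict Implicit.
Unset Printing Implicit Defensive.

Import GRing.Theory.
Local Open Scope ring_scope.

Section Defs.
Variable k : fieldType.

Notation R := {mpoly k[3]}.
Notation V3 := {ffun 'I_3 -> R}.

Definition vx : R := 'X_(ord0 : 'I_3).
Definition vy : R := 'X_(inord 1 : 'I_3).
Definition vz : R := 'X_(ord_max : 'I_3).

(* homogeneous of degree d (total degree); 0 is homogeneous of every degree *)
Definition hom (d : nat) (p : R) : bool := p \is @ishomog1 3 k d mdeg.
Definition homv (d : nat) (v : V3) : Prop := forall t, hom d (v t).

Definition hcomp (d : nat) (p : R) : R :=
  \sum_(m <- msupp p | mdeg m == d) p@_m *: 'X_[m].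

Definition pdeg (p : R) : nat := (msize p).-1.

Definition rel_indep (V : lmodType k) (A B : V -> Prop) (n : nat) (s : 'I_n -> V) :=
  (forall i, A (s i)) /\
  (forall c : 'I_n -> k, B (\sum_(i < n) c i *: s i) -> forall i, c i = 0).

(* dim_k (A / B) = m  (for subspaces B <= A) *)
Definition dim_mod (V : lmodType k) (A B : V -> Prop) (m : nat) : Prop :=
  (exists s : 'I_m -> V, rel_indep A B s) /\
  (forall n (s : 'I_n -> V), rel_indep A B s -> (n <= m)%N).

Definition is_ideal (I : R -> Prop) : Prop :=
  I 0 /\ (forall f g, I f -> I g -> I (f + g)) /\ (forall f g, I g -> I (f * g)).

Definition homog_ideal (I : R -> Prop) : Prop :=
  is_ideal I /\ (forall f d, I f -> I (hcomp d f)).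

Definition eqI (I I' : R -> Prop) : Prop := forall f, I f <-> I' f.

Definition gen (fs : seq R) : R -> Prop :=
  fun p => exists cs : 'I_(size fs) -> R, p = \sum_(i < size fs) cs i * fs`_i.

Definition colon (C I : R -> Prop) : R -> Prop :=
  fun f => forall h, I h -> C (f * h).

Definition regular (fs : seq R) : Prop :=
  ~ gen fs 1 /\
  (forall i, (i < size fs)%N -> forall g, gen (take i fs) (fs`_i * g) -> gen (take i fs) g).

Definition grade (I : R -> Prop) (g : nat) : Prop :=
  ~ I 1 /\
  (exists fs, size fs = g /\ regular fs /\ (forall f, f \in fs -> I f)) /\
  (forall fs, regular fs -> (forall f, f \in fs -> I f) -> (size fs <= g)%N).

(* beta_{i,j}(R/J) = dim_k Tor_i^R(R/J,k)_j = dim_k H_i(K(x,y,z) (x) R/J)_j *)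
(* K_0 = R, K_1 = R^3 (e1,e2,e3), K_2 = R^3 (e23,e13,e12), K_3 = R (e123)    *)
Definition tr (a b c : R) : V3 := [ffun i : 'I_3 => nth 0 [:: a; b; c] i].
Definition c0 (v : V3) := v ord0.
Definition c1 (v : V3) := v (inord 1).
Definition c2 (v : V3) := v ord_max.

Definition kd1 (v : V3) : R := vx * c0 v + vy * c1 v + vz * c2 v.
Definition kd2 (u : V3) : V3 :=
  tr (- (vz * c1 u) - vy * c2 u) (- (vz * c0 u) + vx * c2 u) (vy * c0 u + vx * c1 u).
Definition kd3 (t : R) : V3 := tr (vx * t) (- (vy * t)) (vz * t).

Definition betti (J : R -> Prop) (i j : nat) (m : nat) : Prop :=
  if (j < i)%N then m = 0%N else
  let e := (j - i)%N in
  match i with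
  | 0 => dim_mod (fun u : R => hom e u)
                 (fun u : R => hom e u /\ exists w : V3, J (u - kd1 w)) m
  | 1 => dim_mod (fun v : V3 => homv e v /\ J (kd1 v))
                 (fun v : V3 => homv e v /\ exists w : V3, forall t, J ((v - kd2 w) t)) m
  | 2 => dim_mod (fun u : V3 => homv e u /\ forall t, J (kd2 u t))
                 (fun u : V3 => homv e u /\ exists w : R, forall t, J ((u - kd3 w) t)) m
  | 3 => dim_mod (fun w : R => hom e w /\ forall t, J (kd3 w t))
                 (fun w : R => hom e w /\ J w) m
  | _ => m = 0%N
  end.

Definition hilb (I : R -> Prop) (d m : nat) : Prop :=
  dim_mod (fun p : R => hom d p) I m.

(* perfect: grade I = pd_R(R/I), where pd_R(R/I) = max{ i | beta_{i,j}(R/I) <> 0 } *)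
Definition perfect (I : R -> Prop) : Prop :=
  homog_ideal I /\
  exists g, grade I g /\ (exists j m, (0 < m)%N /\ betti I g j m) /\
            (forall i j, (g < i)%N -> betti I i j 0).

Definition hci (fs : seq R) (g : nat) : Prop :=
  size fs = g /\ regular fs /\ (forall f, f \in fs -> f \is @ishomog 3 k mdeg) /\
  sorted leq (map pdeg fs).

Definition ci_type (fs : seq R) : seq nat := map pdeg fs.

Definition linked (I I' : R -> Prop) (fs : seq R) (g : nat) : Prop :=
  homog_ideal I /\ homog_ideal I' /\ grade I g /\ grade I' g /\
  hci fs g /\ eqI I (colon (gen fs) I') /\ eqI I' (colon (gen fs) I).

Definition SBL (I : R -> Prop) : Prop :=
  perfect I /\
  exists (g s : nat) (Is : nat -> R -> Prop) (Cs : nat -> seq R),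
    eqI (Is 0%N) I /\
    (forall t, (t < s)%N -> linked (Is t) (Is t.+1) (Cs t) g) /\
    (exists fs, hci fs g /\ eqI (Is s) (gen fs)) /\
    (forall t, (t.+1 < s)%N -> forall l, (l < g)%N ->
        (nth 0%N (ci_type (Cs t.+1)) l <= nth 0%N (ci_type (Cs t)) l)%N).

Definition betti_table (n i j : nat) : nat :=
  match i with
  | 1 => if j == 2 then 1 else if j == n + 1 then 2 else if j == n + 3 then 1
         else if j == 2 * n + 4 then 1 else 0
  | 2 => if j == n + 2 then 2 else if j == n + 4 then 1 else if j == 2 * n + 3 then 1
         else if j == 2 * n + 6 then 2 else if j == 3 * n + 4 then 1 else 0
  | 3 => if j == 2 * n + 4 then 1 else if j == 2 * n + 7 then 1
         else if j == 3 * n + 5 then 1 else 0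
  | _ => 0
  end%N.

Definition Jprime_gens (n : nat) : seq R :=
  [:: vx ^+ 2; vy ^+ (2 * n + 1); vz ^+ (2 * n + 4); vy ^+ n * vz;
      vx * vy ^+ (n - 1) * vz; vx * vy * vz ^+ (n + 1)].

End Defs.

(* Main.v *)
(* The ideal J' has finite colength, and its links are monomial: linking a monomial ideal
   by (x^a, y^b, z^c) reflects the complement of its set of standard monomials in the box
   [0,a) x [0,b) x [0,c). Starting from J', four such steps with decreasing boxes end at
   (x, y^(n-2), z^n). All these ideals have grade 3, because a regular sequence in (x, y, z)
   has length at most 3: along f_1, f_2, f_3 the connecting maps of Koszul homology lift the
   class of 1 to a nonzero socle element of R/(f_1, f_2, f_3), on which no f_4 is regular.

   For the Hilbert function h of R/J, the Euler characteristic of the degree j strand of the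
   Koszul complex expresses h(j) - 3 h(j-1) + 3 h(j-2) - h(j-3) by the Betti numbers, which
   determines h. The standard monomials of J' form five boxes; multiplying their generating
   function by (1 - t)^3 shows that their count satisfies the same recursion. *)
From HB Require Import structures.
From mathcomp Require Import all_boot all_algebra.
From mathcomp Require Import zify ring.
From Stdlib Require Import Classical FunctionalExtensionality PropExtensionality.
Require Import Defs.

Set Implicit Arguments.
Unset Strict Implicit.
Unset Printing Implicit Defensive.

Import GRing.Theory.
Local Open Scope ring_scope.

Lemma predext (T : Type) (A B : T -> Prop) : (forall x, A x <-> B x) -> A = B.
Proof.
by move=> AB; apply: functional_extensionality => x; apply: propositional_extensionality.
Qed.

(** * Subspaces and dimensions of subquotients *)

Definition is_subspace (k : fieldType) (V : lmodType k) (A : V -> Prop) : Prop :=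
  A 0 /\ forall c u v, A u -> A v -> A (c *: u + v).

Definition image_plus (U V : zmodType) (f : U -> V) (N : V -> Prop) (v : V) : Prop :=
  exists u, N (v - f u).

Section Subspaces.
Variables (k : fieldType) (V W : lmodType k).
Implicit Types (A B : V -> Prop).

Lemma subspaceZ A c v : is_subspace A -> A v -> A (c *: v).
Proof. by case=> A0 AZ Av; rewrite -[_ *: _]addr0; apply: AZ. Qed.

Lemma subspaceZ_inv A c v : is_subspace A -> c != 0 -> A (c *: v) -> A v.
Proof. by move=> sA c0 Acv; rewrite -(scalerK c0 v); apply: subspaceZ. Qed.

Lemma subspaceD A u v : is_subspace A -> A u -> A v -> A (u + v).
Proof. by case=> A0 AZ Au Av; rewrite -[u]scale1r; apply: AZ. Qed.

Lemma subspaceN A v : is_subspace A -> A v -> A (- v).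
Proof. by move=> sA Av; rewrite -scaleN1r; apply: subspaceZ. Qed.

Lemma subspaceB A u v : is_subspace A -> A u -> A v -> A (u - v).
Proof. by move=> sA Au Av; apply: subspaceD => //; apply: subspaceN. Qed.

Lemma subspaceBr A u v : is_subspace A -> A (u - v) -> A v -> A u.
Proof. by move=> sA Auv Av; rewrite -[u](subrK v); apply: subspaceD. Qed.

Lemma subspace_sum A (I : Type) (r : seq I) (P : pred I) (F : I -> V) :
  is_subspace A -> (forall i, P i -> A (F i)) -> A (\sum_(i <- r | P i) F i).
Proof. by move=> sA; apply: big_ind; [case: sA | move=> u v; apply: subspaceD]. Qed.

Lemma subspace_comb A (I : finType) (c : I -> k) (s : I -> V) :
  is_subspace A -> (forall i, A (s i)) -> A (\sum_i c i *: s i).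
Proof. by move=> sA As; apply: subspace_sum => // i _; apply: subspaceZ. Qed.

Lemma subspaceI A B :
  is_subspace A -> is_subspace B -> is_subspace (fun v => A v /\ B v).
Proof.
move=> [A0 AZ] [B0 BZ]; split=> // c u v [Au Bu] [Av Bv].
by split; [apply: AZ | apply: BZ].
Qed.

Lemma subspace_preim (f : {linear V -> W}) (B : W -> Prop) :
  is_subspace B -> is_subspace (fun v => B (f v)).
Proof.
by move=> [B0 BZ]; split=> [|c u v Bu Bv]; rewrite ?raddf0 // linearP; apply: BZ.
Qed.

Lemma subspace_fixed (f : {linear V -> V}) : is_subspace (fun v => f v = v).
Proof. by split=> [|c u v Eu Ev]; rewrite ?raddf0 // linearP Eu Ev. Qed.

Lemma subspace_image_plus (f : {linear W -> V}) A :
  is_subspace A -> is_subspace (image_plus f A).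
Proof.
move=> [A0 AZ]; split=> [|c u v [w Aw] [w' Aw']]; first by exists 0; rewrite raddf0 subr0.
by exists (c *: w + w'); rewrite linearP opprD addrACA -scalerBr; apply: AZ.
Qed.

Lemma sub_image_plus (f : {linear W -> V}) A v : A v -> image_plus f A v.
Proof. by exists 0; rewrite raddf0 subr0. Qed.

Lemma subspace_ffun (I : finType) A :
  is_subspace A -> is_subspace (fun v : {ffun I -> V} => forall i, A (v i)).
Proof.
by move=> [A0 AZ]; split=> [i|c u v Au Av i]; rewrite !ffunE //; apply: AZ.
Qed.

End Subspaces.

Section Dimension.
Variable k : fieldType.

Definition is_basis_mod (V : lmodType k) (A B : V -> Prop) (I : finType) (s : I -> V) : Prop :=
  [/\ forall i, A (s i),
      forall c : I -> k, B (\sum_i c i *: s i) -> forall i, c i = 0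
    & forall a, A a -> exists c : I -> k, B (a - \sum_i c i *: s i)].

Section Subquotients.
Variable V : lmodType k.
Implicit Types (A B C : V -> Prop).

Lemma dim_mod_basis A B m :
  is_subspace B -> dim_mod A B m -> exists s : 'I_m -> V, is_basis_mod A B s.
Proof.
move=> sB [[s [As inds]] maxs]; exists s; split=> // a Aa.
apply: NNPP => nspan.
suff : rel_indep A B (fun i : 'I_m.+1 => oapp s a (unlift ord0 i)).
  by move/maxs; rewrite ltnn.
split=> [i|c]; first by case: unliftP => [j _|_] /=; [apply: As | apply: Aa].
rewrite big_ord_recl unlift_none /=.
under eq_bigr do rewrite liftK /=.
move=> Bc; have c0 : c ord0 = 0.
  apply/eqP/negPn/negP => c0; apply: nspan.
  exists (fun i => - ((c ord0)^-1 * c (lift ord0 i))).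
  apply: (subspaceZ_inv sB c0); rewrite scalerBr; congr B: Bc; congr (_ + _).
  rewrite scaler_sumr -sumrN; apply: eq_bigr => i _.
  by rewrite scalerA mulrN mulVKf // scaleNr opprK.
move=> i; case: (unliftP ord0 i) => [j ->|->] //.
by apply: (inds (fun j => c (lift ord0 j))); move: Bc; rewrite c0 scale0r add0r.
Qed.

Lemma basis_dim_mod A B (I : finType) (s : I -> V) :
  is_subspace B -> is_basis_mod A B s -> dim_mod A B #|I|.
Proof.
move=> sB [As inds span]; split.
  exists (s \o enum_val); split=> [i|c Bc i]; first exact: As.
  rewrite -[i]enum_valK; apply: (inds (c \o enum_rank)); congr B: Bc => /=.
  rewrite [RHS](reindex (@enum_val _ I)) /=; last exact/onW_bij/enum_val_bij.
  by apply: eq_bigr => j _; rewrite enum_valK.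
move=> n t [At indt]; have /fin_all_exists[c cP] := fun i => span (t i) (At i).
pose M := \matrix_(i < n, j < #|I|) c i (enum_val j).
suff : row_free M by move/eqP <-; apply: rank_leq_col.
apply: inj_row_free => v vM; apply/rowP => i; rewrite mxE.
apply: (indt (fun i => v 0 i)).
have -> : \sum_i v 0 i *: t i = \sum_i v 0 i *: (t i - \sum_j c i j *: s j).
  under [RHS]eq_bigr do rewrite scalerBr scaler_sumr.
  rewrite sumrB exchange_big /= [X in _ - X]big1 ?subr0 // => j _.
  under eq_bigr do rewrite scalerA.
  have := congr1 (fun r : 'rV_ _ => r 0 (enum_rank j)) vM; rewrite !mxE -scaler_suml.
  by under eq_bigr do rewrite mxE enum_rankK; move=> ->; rewrite scale0r.
exact: subspace_comb.
Qed.

Lemma dim_mod_unique A B m m' : dim_mod A B m -> dim_mod A B m' -> m = m'.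
Proof.
move=> [[s Hs] ms] [[s' Hs'] ms']; apply/eqP; rewrite eqn_leq.
by rewrite (ms' _ _ Hs) (ms _ _ Hs').
Qed.

Lemma eq_dim_mod A B A' B' m :
  is_subspace A -> (forall v, A v <-> A' v) -> (forall v, A v -> (B v <-> B' v)) ->
  dim_mod A B m -> dim_mod A' B' m.
Proof.
move=> sA /predext <- BB'.
have indepE n (t : 'I_n -> V) : rel_indep A B t <-> rel_indep A B' t.
  by split=> -[At indt]; split=> // c Bc; apply: indt; apply/BB' => //;
    apply: subspace_comb.
move=> [[s /indepE s_indep] maxs]; split=> [|n t /indepE]; [by exists s | exact: maxs].
Qed.

Lemma dim_mod_exists A B m :
  (forall n (s : 'I_n -> V), rel_indep A B s -> (n <= m)%N) -> exists p, dim_mod A B p.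
Proof.
elim: m => [|m IH] bound.
  by exists 0%N; split=> //; exists (fun _ => 0); split=> [[]|c _ []].
case: (classic (exists s : 'I_m.+1 -> V, rel_indep A B s)) => [[s Hs]|no].
  by exists m.+1; split=> //; exists s.
apply: IH => n s Hs; have := bound n s Hs; rewrite leq_eqVlt => /orP[/eqP E|//].
by case: no; move: s Hs; rewrite E => s Hs; exists s.
Qed.

Lemma dim_modD A B C p q :
  is_subspace B -> is_subspace C ->
  (forall v, B v -> C v) -> (forall v, C v -> A v) ->
  dim_mod A C p -> dim_mod C B q -> dim_mod A B (p + q).
Proof.
move=> sB sC BC CA /(dim_mod_basis sC)[s [As inds spans]].
move=> /(dim_mod_basis sB)[t [Ct indt spant]].
have -> : (p + q)%N = #|{: 'I_p + 'I_q}| by rewrite card_sum !card_ord.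
apply: (@basis_dim_mod _ _ _ (fun i => match i with inl i => s i | inr j => t j end)) => //.
split=> [[i|j]|c|a Aa]; [exact: As | exact/CA/Ct | |].
- rewrite big_sumType /= => Bc.
  have cl : forall i, c (inl i) = 0.
    apply: (inds (c \o inl)); rewrite /= -[X in C X](addrK (\sum_j c (inr j) *: t j)).
    by apply: subspaceB => //; [apply: BC | apply: subspace_comb].
  have cr : forall j, c (inr j) = 0.
    apply: (indt (c \o inr)); congr B: Bc.
    by rewrite big1 ?add0r // => i _; rewrite cl scale0r.
  by case.
- have [c Cc] := spans a Aa; have [d Bd] := spant _ Cc.
  exists (fun i => match i with inl i => c i | inr j => d j end).
  by rewrite big_sumType opprD addrA.
Qed.

Lemma dim_mod_split A B C m :
  is_subspace B -> is_subspace C ->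
  (forall v, B v -> C v) -> (forall v, C v -> A v) -> dim_mod A B m ->
  exists p q, [/\ dim_mod A C p, dim_mod C B q & m = (p + q)%N].
Proof.
move=> sB sC BC CA dAB; have [_ maxAB] := dAB.
have [p dp] : exists p, dim_mod A C p.
  apply: (@dim_mod_exists _ _ m) => n s [As inds]; apply: (maxAB _ s); split=> //.
  by move=> c /BC; apply: inds.
have [q dq] : exists q, dim_mod C B q.
  apply: (@dim_mod_exists _ _ m) => n s [Cs inds]; apply: (maxAB _ s); split=> // i.
  exact: CA.
by exists p, q; split=> //; apply: dim_mod_unique dAB _; apply: dim_modD dp dq.
Qed.

Lemma dim_mod0 A B : (forall v, A v -> B v) -> is_subspace B -> dim_mod A B 0.
Proof.
move=> AB sB; rewrite -(card_ord 0).
apply: (@basis_dim_mod _ _ _ (fun _ => 0)) => //; split=> [[]//|c _ []//|a Aa].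
by exists (fun _ => 0); rewrite big_ord0 subr0; apply: AB.
Qed.

Lemma dim_mod_gt0 A B v m :
  is_subspace B -> A v -> ~ B v -> dim_mod A B m -> (0 < m)%N.
Proof.
move=> sB Av nBv [_ maxs]; apply: (maxs _ (fun _ : 'I_1 => v)); split=> // c.
rewrite big_ord1 => Bc i; rewrite (ord1 i); apply/eqP/negPn/negP => c0.
by apply: nBv; apply: subspaceZ_inv Bc.
Qed.

End Subquotients.

Lemma dim_mod_iso (V W : lmodType k) (f : {linear V -> W})
    (A B : V -> Prop) (A' B' : W -> Prop) m :
  is_subspace A -> is_subspace B -> is_subspace B' ->
  (forall v, A v -> A' (f v)) ->
  (forall v, A v -> (B' (f v) <-> B v)) ->
  (forall w, A' w -> exists2 v, A v & B' (w - f v)) ->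
  dim_mod A B m -> dim_mod A' B' m.
Proof.
move=> sA sB sB' fA fB surj /(dim_mod_basis sB)[s [As inds span]].
have combE (c : 'I_m -> k) : \sum_i c i *: f (s i) = f (\sum_i c i *: s i).
  by rewrite linear_sum; apply: eq_bigr => i _; rewrite linearZ.
rewrite -[m]card_ord; apply: (@basis_dim_mod _ _ _ _ (f \o s)) => //; split=> [i|c|w].
- exact: fA.
- by rewrite combE => /fB-/(_ (subspace_comb _ sA As)); apply: inds.
move=> /surj[v Av Bv]; have [c Bc] := span v Av; exists c.
rewrite combE -[w](subrK (f v)) -addrA -raddfB; apply: subspaceD => //.
by apply/fB => //; apply: subspaceB => //; apply: subspace_comb.
Qed.

Lemma dim_mod_ffun (V : lmodType k) (I : finType) (A B : V -> Prop) m :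
  is_subspace A -> is_subspace B -> dim_mod A B m ->
  dim_mod (fun v : {ffun I -> V} => forall i, A (v i)) (fun v => forall i, B (v i))
    (#|I| * m).
Proof.
move=> [A0 _] sB /(dim_mod_basis sB)[s [As inds span]].
rewrite -[m in (_ * m)%N]card_ord -card_prod.
pose t (x : I * 'I_m) := [ffun i => if i == x.1 then s x.2 else 0].
have combE (c : I * 'I_m -> k) i : (\sum_x c x *: t x) i = \sum_j c (i, j) *: s j.
  pose G a b := c (a, b) *: (if i == a then s b else 0).
  rewrite sum_ffunE (eq_bigr (fun x => G x.1 x.2)) => [|[a b] _]; last by rewrite !ffunE.
  rewrite -(pair_bigA _ G) /= (bigD1 i) //= [X in _ + X]big1 => [|a ai]; last first.
    by rewrite big1 // => b _; rewrite /G eq_sym (negPf ai) scaler0.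
  by rewrite addr0; apply: eq_bigr => b _; rewrite /G eqxx.
apply: (@basis_dim_mod _ _ _ _ t); first exact: subspace_ffun.
split=> [x i|c Bc [i j]|v Av].
- by rewrite ffunE; case: eqP => _; first exact: As.
- by apply: (inds (fun j => c (i, j))); rewrite -combE.
- have /fin_all_exists[c cP] := fun i => span _ (Av i).
  by exists (fun x => c x.1 x.2) => i; rewrite !ffunE combE.
Qed.

End Dimension.

Section Strands.
Variables (k : fieldType) (V W : lmodType k).
Variables (f : {linear V -> W}) (prV : {linear V -> V}) (prW : {linear W -> W}).
Implicit Types (A B M : V -> Prop) (N : W -> Prop).

Definition strand (U : Type) (pr : U -> U) (A : U -> Prop) (u : U) : Prop := pr u = u /\ A u.

Lemma subspace_strand A : is_subspace A -> is_subspace (strand prV A).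
Proof. by move=> sA; apply: subspaceI => //; apply: subspace_fixed. Qed.

Hypothesis prf : forall v, prW (f v) = f (prV v).
Hypothesis pr_idem : forall v, prV (prV v) = prV v.

Lemma dim_mod_image_strand N m :
  is_subspace N -> (forall w, N w -> N (prW w)) ->
  dim_mod (fun v => prV v = v) (strand prV (fun v => N (f v))) m ->
  dim_mod (strand prW (image_plus f N)) (strand prW N) m.
Proof.
move=> sN prN; have N0 : N 0 by case: sN.
apply: (@dim_mod_iso _ _ _ f).
- exact: subspace_fixed.
- by apply: subspace_strand; apply: subspace_preim.
- by apply: subspaceI => //; apply: subspace_fixed.
- by move=> v Ev; split; [rewrite prf Ev | exists v; rewrite subrr].
- by move=> v Ev; split=> -[_ Nv]; split; rewrite ?prf ?Ev.
- move=> w [Ew [v /prN Nv]]; exists (prV v) => //.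
  by move: Nv; rewrite raddfB /= prf Ew; split; rewrite // raddfB /= Ew prf pr_idem.
Qed.

(* Rank-nullity for f : V/M -> W/N. The dimension a of V/M is the sum of the dimension b of
   the homology ker f / B, of r = dim B/M, and of the rank r' of f. *)
Lemma dim_mod_chain M B N a b r :
  is_subspace M -> is_subspace B -> is_subspace N -> (forall w, N w -> N (prW w)) ->
  (forall v, M v -> B v) -> (forall v, B v -> N (f v)) ->
  dim_mod (fun v => prV v = v) (strand prV M) a ->
  dim_mod (strand prV (fun v => N (f v))) (strand prV B) b ->
  dim_mod (strand prV B) (strand prV M) r ->
  exists2 r', dim_mod (strand prW (image_plus f N)) (strand prW N) r' & a = (b + r + r')%N.
Proof.
move=> sM sB sN prN MB BN da db dr.
have sZ : is_subspace (fun v => N (f v)) by apply: subspace_preim.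
have dZ : dim_mod (strand prV (fun v => N (f v))) (strand prV M) (b + r).
  apply: dim_modD db dr; try exact: subspace_strand.
    by move=> v [? Mv]; split; last exact: MB.
  by move=> v [? Bv]; split; last exact: BN.
have [|||p [q [dp dq ->]]] := dim_mod_split _ (subspace_strand sZ) _ _ da.
- exact: subspace_strand.
- by move=> v [? Mv]; split; last exact/BN/MB.
- by move=> v [].
exists p; first exact: dim_mod_image_strand.
by rewrite (dim_mod_unique dq dZ) addnC.
Qed.

Lemma dim_mod_strand (lt : bool) (H A B : V -> Prop) m :
  is_subspace A -> is_subspace B ->
  (lt -> forall v, prV v = v -> v = 0) -> (~~ lt -> forall v, H v <-> prV v = v) ->
  (if lt then m = 0%N
   else dim_mod (fun v => H v /\ A v) (fun v => H v /\ B v) m) ->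
  dim_mod (strand prV A) (strand prV B) m.
Proof.
move=> sA sB; case: lt => [/(_ isT) pr0 _ ->|_ /(_ isT)/predext ->] //.
apply: dim_mod0; last exact: subspace_strand.
by move=> v [Ev _]; split=> //; rewrite (pr0 v Ev); case: sB.
Qed.

End Strands.

(** * Ideals of k[x, y, z] and the Koszul complex *)

Lemma ord3P (P : 'I_3 -> Prop) : P ord0 -> P (inord 1) -> P ord_max -> forall i, P i.
Proof.
move=> P0 P1 P2 [[|[|[|i]]] // lti].
- by rewrite (_ : Ordinal lti = ord0) //; apply: val_inj.
- by rewrite (_ : Ordinal lti = inord 1) //; apply: val_inj; rewrite /= inordK.
- by rewrite (_ : Ordinal lti = ord_max) //; apply: val_inj.
Qed.

Lemma big_ord3 (T : Type) (idx : T) (op : Monoid.law idx) (F : 'I_3 -> T) :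
  \big[op/idx]_i F i = op (op (F ord0) (F (inord 1))) (F ord_max).
Proof.
rewrite !big_ord_recl big_ord0 Monoid.mulm1 Monoid.mulmA.
by congr (op (op _ (F _)) (F _)); apply: val_inj; rewrite /= ?inordK.
Qed.

Section Ideals.
Variable k : fieldType.
Local Notation R := {mpoly k[3]}.
Local Notation V3 := {ffun 'I_3 -> R}.
Implicit Types (f g p : R) (I : R -> Prop) (fs : seq R) (a u v : V3).

Lemma ideal_mull I f g : is_ideal I -> I g -> I (f * g).
Proof. by case=> _ [_]; apply. Qed.

Lemma idealZ I (c : k) f : is_ideal I -> I f -> I (c *: f).
Proof. by move=> iI If; rewrite -mul_mpolyC; apply: ideal_mull. Qed.

Lemma ideal_sum I (T : Type) (r : seq T) (P : pred T) (F : T -> R) :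
  is_ideal I -> (forall i, P i -> I (F i)) -> I (\sum_(i <- r | P i) F i).
Proof. by case=> I0 [ID _] IF; apply: (big_ind I). Qed.

Lemma ideal_subspace I : is_ideal I -> is_subspace I.
Proof.
move=> iI; have [I0 [ID _]] := iI; split=> // c p q Ip Iq.
by apply: ID => //; apply: idealZ.
Qed.

Lemma ideal_msupp I f : is_ideal I -> (forall m, m \in msupp f -> I 'X_[m]) -> I f.
Proof.
move=> iI If; rewrite (mpolyE f) big_seq; apply: ideal_sum => // m /If.
exact: idealZ.
Qed.

Lemma gen_is_ideal fs : is_ideal (gen fs).
Proof.
split; first by exists (fun _ => 0); rewrite big1 // => i _; rewrite mul0r.
split=> [f g [c ->] [d ->]|f g [c ->]].
  exists (fun i => c i + d i).
  by rewrite -big_split; apply: eq_bigr => i _; rewrite mulrDl.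
exists (fun i => f * c i); rewrite big_distrr /=.
by apply: eq_bigr => i _; rewrite mulrA.
Qed.

Lemma mem_gen fs f : f \in fs -> gen fs f.
Proof.
move=> ffs; have lt_i : (index f fs < size fs)%N by rewrite index_mem.
exists (fun i => (i == Ordinal lt_i)%:R).
rewrite (bigD1 (Ordinal lt_i)) //= eqxx mul1r nth_index // big1 ?addr0 //.
by move=> i /negPf->; rewrite mul0r.
Qed.

Lemma gen_min fs I f :
  is_ideal I -> (forall g, g \in fs -> I g) -> gen fs f -> I f.
Proof.
move=> iI Ifs [c ->]; apply: ideal_sum => // i _.
by apply: ideal_mull => //; apply: Ifs; rewrite mem_nth.
Qed.

Lemma gen_nil f : gen [::] f <-> f = 0.
Proof.
by split=> [[c ->]|->]; [rewrite big_ord0 | case: (gen_is_ideal [::])].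
Qed.

Lemma image_plus_mul_is_ideal I f : is_ideal I -> is_ideal (image_plus ( *%R f) I).
Proof.
move=> [I0 [ID IM]]; split; first by exists 0; rewrite mulr0 subr0.
split=> [g h [p Ip] [q Iq]|g h [p Ip]].
  by exists (p + q); rewrite mulrDr opprD addrACA; apply: ID.
by exists (g * p); rewrite mulrCA -mulrBr; apply: IM.
Qed.

Lemma gen_rcons fs f : gen (rcons fs f) = image_plus ( *%R f) (gen fs).
Proof.
have iG := gen_is_ideal (rcons fs f); have [G0 _] := gen_is_ideal fs.
apply: predext => g; split=> [|[p Gp]].
  apply: gen_min => [|h]; first exact/image_plus_mul_is_ideal/gen_is_ideal.
  rewrite mem_rcons inE => /predU1P[->|hfs]; first by exists 1; rewrite mulr1 subrr.
  by exists 0; rewrite mulr0 subr0; apply: mem_gen.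
apply: (subspaceBr (v := f * p) (ideal_subspace iG)).
  by apply: gen_min Gp => // h hfs; apply: mem_gen; rewrite mem_rcons inE hfs orbT.
by rewrite mulrC; apply: ideal_mull => //; apply: mem_gen; rewrite mem_rcons mem_head.
Qed.

Lemma trE (p q r : R) :
  (tr p q r ord0 = p) * (tr p q r (inord 1) = q) * (tr p q r ord_max = r).
Proof. by rewrite /tr !ffunE /= inordK. Qed.

Lemma ffun_addE u v t : (u + v) t = u t + v t. Proof. by rewrite ffunE. Qed.

Lemma ffun_scaleE (c : k) v t : (c *: v) t = c *: v t. Proof. by rewrite ffunE. Qed.

Lemma kd1E v : kd1 v = \sum_i 'X_i * v i.
Proof. by rewrite big_ord3. Qed.

Lemma kd1_linear : linear (@kd1 k).
Proof.
move=> c u v; rewrite !kd1E scaler_sumr -big_split; apply: eq_bigr => i _ /=.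
by rewrite !ffunE mulrDr scalerAr.
Qed.
HB.instance Definition _ := GRing.isLinear.Build k V3 R _ (@kd1 k) kd1_linear.

Lemma kd2_linear : linear (@kd2 k).
Proof.
move=> c u v; apply/ffunP; apply: ord3P; rewrite /kd2 /c0 /c1 /c2
  !(ffun_addE, ffun_scaleE, trE) -!mul_mpolyC; ring.
Qed.
HB.instance Definition _ := GRing.isLinear.Build k V3 V3 _ (@kd2 k) kd2_linear.

Lemma kd3_linear : linear (@kd3 k).
Proof.
move=> c p q; apply/ffunP; apply: ord3P; rewrite /kd3
  !(ffun_addE, ffun_scaleE, trE) -!mul_mpolyC; ring.
Qed.
HB.instance Definition _ := GRing.isLinear.Build k R V3 _ (@kd3 k) kd3_linear.

Lemma kd1_kd2 u : kd1 (kd2 u) = 0 :> R.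
Proof. by rewrite /kd1 /kd2 /c0 /c1 /c2 !trE; ring. Qed.

Lemma kd2_kd3 p : kd2 (kd3 p) = 0 :> V3.
Proof. by apply/ffunP; apply: ord3P; rewrite [RHS]ffunE /kd2 /kd3 /c0 /c1 /c2 !trE; ring. Qed.

Definition idealv I v : Prop := forall t, I (v t).

Lemma idealv_subspace I : is_ideal I -> is_subspace (idealv I).
Proof. by move=> iI; apply/subspace_ffun/ideal_subspace. Qed.

Lemma idealv_tr I p q r : I p -> I q -> I r -> idealv I (tr p q r).
Proof. by move=> Ip Iq Ir; apply: ord3P; rewrite trE. Qed.

Lemma kd1_ideal I v : is_ideal I -> idealv I v -> I (kd1 v).
Proof.
move=> iI Iv; rewrite kd1E; apply: ideal_sum => // i _.
exact: ideal_mull.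
Qed.

Lemma kd2_ideal I v : is_ideal I -> idealv I v -> idealv I (kd2 v).
Proof.
move=> iI Iv; have sI := ideal_subspace iI.
have IM f t : I (f * v t) by apply: ideal_mull.
have IN f t : I (- (f * v t)) := subspaceN sI (IM f t).
apply: idealv_tr; first exact: (subspaceB sI (IN _ _) (IM _ _)).
- exact: (subspaceD sI (IN _ _) (IM _ _)).
- exact: (subspaceD sI (IM _ _) (IM _ _)).
Qed.

Lemma kd3_ideal I p : is_ideal I -> I p -> idealv I (kd3 p).
Proof.
move=> iI Ip; apply: idealv_tr; try exact: ideal_mull.
exact: (subspaceN (ideal_subspace iI) (ideal_mull _ iI Ip)).
Qed.

Lemma mcoeff0_kd1 v : (kd1 v)@_0%MM = 0.
Proof.
rewrite kd1E raddf_sum big1 //= => i _; rewrite rmorphM /= mcoeffX mnm1_eq0.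
by rewrite mul0r.
Qed.

Lemma mcoeff0_eq0P p : p@_0%MM = 0 <-> exists v, p = kd1 v.
Proof.
split=> [p0|[v ->]]; last exact: mcoeff0_kd1.
rewrite (mpolyE p) big_seq; apply: (big_ind (fun q => exists v, q = kd1 v)).
- by exists 0; rewrite raddf0.
- by move=> _ _ [u ->] [v ->]; exists (u + v); rewrite raddfD.
move=> m; rewrite mcoeff_msupp => pm.
have m_neq0 : m != 0%MM by apply: contraNneq pm => ->; rewrite p0.
have [i mi] : exists i, (U_(i) <= m)%MM.
  apply/existsP; apply: contraR m_neq0 => /existsPn no; apply/eqP/mnmP => i.
  rewrite mnm0E; apply/eqP; rewrite -leqn0 leqNgt; apply: contra (no i) => m_gt0.
  by apply/mnm_lepP => j; rewrite mnm1E; case: eqP => [<-|].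
exists [ffun j => (j == i)%:R * (p@_m *: 'X_[m - U_(i)])].
rewrite kd1E (bigD1 i) //= ffunE eqxx mul1r big1 ?addr0 => [|j /negPf ji].
  by rewrite -scalerAr -mpolyXD addmC submK.
by rewrite ffunE ji mul0r mulr0.
Qed.

Definition mulv f v : V3 := [ffun t => f * v t].

(* Exterior multiplication by a is a null-homotopy of the multiplication by kd1 a on the
   Koszul complex. *)
Definition wedge1 a v : V3 :=
  tr (c1 a * c2 v - c2 a * c1 v) (c0 a * c2 v - c2 a * c0 v) (c0 a * c1 v - c1 a * c0 v).

Definition wedge2 a u : R := c0 a * c0 u - c1 a * c1 u + c2 a * c2 u.

Lemma mulvE f v t : mulv f v t = f * v t. Proof. by rewrite ffunE. Qed.

Lemma mulvB f : {morph mulv f : u v / u - v}.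
Proof. by move=> u v; apply/ffunP => t; rewrite !ffunE mulrBr. Qed.

Lemma kd1_mulv f v : kd1 (mulv f v) = f * kd1 v.
Proof. by rewrite !kd1E mulr_sumr; apply: eq_bigr => i _; rewrite mulvE mulrCA. Qed.

Lemma kd2_mulv f v : kd2 (mulv f v) = mulv f (kd2 v).
Proof.
by apply/ffunP; apply: ord3P; rewrite /kd2 /c0 /c1 /c2 !(mulvE, trE); ring.
Qed.

Lemma kd3_mulv f p : kd3 (f * p) = mulv f (kd3 p).
Proof. by apply/ffunP; apply: ord3P; rewrite /kd3 !(mulvE, trE); ring. Qed.

Lemma kd2_wedge1 a v : kd2 (wedge1 a v) + mulv (kd1 v) a = mulv (kd1 a) v.
Proof.
by apply/ffunP; apply: ord3P;
  rewrite /kd2 /kd1 /wedge1 /c0 /c1 /c2 !(ffun_addE, mulvE, trE); ring.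
Qed.

Lemma kd3_wedge2 a u : kd3 (wedge2 a u) + wedge1 a (kd2 u) = mulv (kd1 a) u.
Proof.
by apply/ffunP; apply: ord3P;
  rewrite /kd3 /kd2 /kd1 /wedge1 /wedge2 /c0 /c1 /c2 !(ffun_addE, mulvE, trE); ring.
Qed.

Lemma mulv_ideal I f v : is_ideal I -> I f -> idealv I (mulv f v).
Proof. by move=> iI If t; rewrite mulvE mulrC; apply: ideal_mull. Qed.

Lemma wedge1_ideal I a v : is_ideal I -> idealv I v -> idealv I (wedge1 a v).
Proof.
move=> iI Iv; have sI := ideal_subspace iI.
have IM f t : I (f * v t) by apply: ideal_mull.
by apply: idealv_tr; apply: (subspaceB sI (IM _ _) (IM _ _)).
Qed.

Lemma idealv_gen_rcons fs f :
  idealv (gen (rcons fs f)) = image_plus (mulv f) (idealv (gen fs)).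
Proof.
rewrite gen_rcons; apply: predext => v; split=> [/fin_all_exists[u Gu]|[u Gu] t].
  by exists [ffun t => u t] => t; rewrite !ffunE.
by exists (u t); have := Gu t; rewrite !ffunE.
Qed.

End Ideals.

Definition nonexact_mod (k : fieldType) (U V W : lmodType k) (d' : U -> V) (d : V -> W)
    (N : V -> Prop) (M : W -> Prop) : Prop :=
  exists2 v, M (d v) & ~ image_plus d' N v.

(* As f is regular on K/N and null-homotopic, the connecting maps of the exact sequence
   0 -> K/N -> K/N -> K/(N + fK) -> 0 are surjective; h1 lifts homology classes along them. *)
Lemma nonexact_mod_regular (k : fieldType) (U V W X : lmodType k)
    (d2 : {linear U -> V}) (d1 : {linear V -> W}) (d0 : W -> X) (h1 : W -> V) (h0 : X -> W)
    (fV : V -> V) (fW : W -> W) (NV : V -> Prop) (NW : W -> Prop) (NX : X -> Prop) :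
  (forall u, d1 (d2 u) = 0) -> (forall w, d1 (h1 w) + h0 (d0 w) = fW w) ->
  (forall v, d1 (fV v) = fW (d1 v)) -> {morph fW : u v / u - v} ->
  is_subspace NW -> (forall v, NV v -> NW (d1 v)) -> (forall x, NX x -> NW (h0 x)) ->
  (forall w, NW (fW w) -> NW w) ->
  nonexact_mod d1 d0 NW NX -> nonexact_mod d2 d1 (image_plus fV NV) (image_plus fW NW).
Proof.
move=> d12 homotopy d1f fWB sNW d1N h0N regular [w Nw nb].
have Nh := h0N _ Nw; exists (h1 w).
  by exists w; rewrite -homotopy opprD addrA subrr sub0r; apply: subspaceN.
move=> [u [v /d1N Nv]]; apply: nb; exists v; apply: regular.
rewrite fWB -homotopy addrAC; apply: subspaceD => //.
by move: Nv; rewrite !raddfB /= d12 subr0 d1f.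
Qed.

Section KoszulDepth.
Variable k : fieldType.
Local Notation R := {mpoly k[3]}.
Local Notation V3 := {ffun 'I_3 -> R}.

Section Step.
Variables (fs : seq R) (a : V3).
Hypothesis regular_a : forall g, gen fs (kd1 a * g) -> gen fs g.
Let fs' := rcons fs (kd1 a).

Let regularv_a v : idealv (gen fs) (mulv (kd1 a) v) -> idealv (gen fs) v.
Proof. by move=> Gv t; apply: regular_a; rewrite -mulvE. Qed.

Lemma nonexact_koszul1 :
  ~ image_plus (@kd1 k) (gen fs) 1 -> nonexact_mod (@kd2 k) (@kd1 k) (idealv (gen fs')) (gen fs').
Proof.
move=> n1; rewrite idealv_gen_rcons gen_rcons.
apply: (@nonexact_mod_regular _ _ _ _ R _ _ (fun _ => 0) (fun p => mulv p a) (fun _ => 0) _ _ _ _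
  (fun _ => True)) => //.
- exact: kd1_kd2.
- by move=> p; rewrite /= addr0 kd1_mulv mulrC.
- exact: kd1_mulv.
- exact: mulrBr.
- exact/ideal_subspace/gen_is_ideal.
- by move=> v Gv; apply: kd1_ideal => //; apply: gen_is_ideal.
- by case: (gen_is_ideal fs).
- by exists 1.
Qed.

Lemma nonexact_koszul2 :
  nonexact_mod (@kd2 k) (@kd1 k) (idealv (gen fs)) (gen fs) ->
  nonexact_mod (@kd3 k) (@kd2 k) (idealv (gen fs')) (idealv (gen fs')).
Proof.
rewrite idealv_gen_rcons.
apply: (@nonexact_mod_regular _ _ _ _ _ _ _ _ (wedge1 a) (fun p => mulv p a)).
- exact: kd2_kd3.
- exact: kd2_wedge1.
- exact: kd2_mulv.
- exact: mulvB.
- exact/idealv_subspace/gen_is_ideal.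
- by move=> v Gv; apply: kd2_ideal => //; apply: gen_is_ideal.
- by move=> p Gp; apply: mulv_ideal => //; apply: gen_is_ideal.
- exact: regularv_a.
Qed.

Lemma nonexact_koszul3 :
  nonexact_mod (@kd3 k) (@kd2 k) (idealv (gen fs)) (idealv (gen fs)) ->
  nonexact_mod (\0 : R -> R) (@kd3 k) (gen fs') (idealv (gen fs')).
Proof.
rewrite idealv_gen_rcons gen_rcons.
apply: (@nonexact_mod_regular _ _ _ _ _ _ _ _ (wedge2 a) (wedge1 a)).
- by move=> p; rewrite raddf0.
- exact: kd3_wedge2.
- exact: kd3_mulv.
- exact: mulvB.
- exact/idealv_subspace/gen_is_ideal.
- by move=> p Gp; apply: kd3_ideal => //; apply: gen_is_ideal.
- by move=> u Gu; apply: wedge1_ideal => //; apply: gen_is_ideal.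
- exact: regularv_a.
Qed.

End Step.

Lemma wedge2_kd3 (a : V3) (p : R) : wedge2 a (kd3 p) = kd1 a * p.
Proof. by rewrite /wedge2 /kd3 /kd1 /c0 /c1 /c2 !trE; ring. Qed.

Lemma wedge2_ideal (I : R -> Prop) (a u : V3) : is_ideal I -> idealv I u -> I (wedge2 a u).
Proof.
move=> iI Iu; have sI := ideal_subspace iI.
have IM t s : I (a t * u s) by apply: ideal_mull.
exact: (subspaceD sI (subspaceB sI (IM _ _) (IM _ _)) (IM _ _)).
Qed.

(* R/(f_1, f_2, f_3) has a nonzero socle, hence no f_4 in (x, y, z) is regular on it. *)
Lemma regular_size_le3 (fs : seq R) :
  regular fs -> (forall f, f \in fs -> f@_0%MM = 0) -> (size fs <= 3)%N.
Proof.
move=> [_ reg] fs0; rewrite leqNgt; apply/negP => fs_gt3.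
have nth_kd1 i : (i < 4)%N -> exists a, fs`_i = kd1 a.
  by move=> i4; apply/mcoeff0_eq0P/fs0/mem_nth/(leq_trans i4).
have takeS i : (i < 4)%N -> take i.+1 fs = rcons (take i fs) fs`_i.
  by move=> i4; apply: take_nth; apply: leq_trans i4 _.
have regi i : (i < 4)%N -> forall g, gen (take i fs) (fs`_i * g) -> gen (take i fs) g.
  by move=> i4; apply: reg; apply: leq_trans i4 _.
have [a0 E0] := nth_kd1 0%N isT; have [a1 E1] := nth_kd1 1%N isT.
have [a2 E2] := nth_kd1 2%N isT; have [a3 E3] := nth_kd1 3%N isT.
have n0 : ~ image_plus (@kd1 k) (gen (take 0 fs)) 1.
  rewrite take0 => -[v /gen_nil/eqP]; rewrite subr_eq0 => /eqP/(congr1 (mcoeff 0%MM))/eqP.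
  by rewrite mcoeff0_kd1 mcoeff1 eqxx oner_eq0.
have n1 : nonexact_mod (@kd2 k) (@kd1 k) (idealv (gen (take 1 fs))) (gen (take 1 fs)).
  by rewrite takeS // E0; apply: nonexact_koszul1 => //; rewrite -E0; apply: regi.
have n2 : nonexact_mod (@kd3 k) (@kd2 k) (idealv (gen (take 2 fs))) (idealv (gen (take 2 fs))).
  by rewrite takeS // E1; apply: nonexact_koszul2 => //; rewrite -E1; apply: regi.
have [w Gw nGw] : nonexact_mod (\0 : R -> R) (@kd3 k) (gen (take 3 fs)) (idealv (gen (take 3 fs))).
  by rewrite takeS // E2; apply: nonexact_koszul3 => //; rewrite -E2; apply: regi.
apply/nGw/sub_image_plus/regi => //.
by rewrite E3 -wedge2_kd3; apply: wedge2_ideal => //; apply: gen_is_ideal.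
Qed.

Lemma homog_ideal_mcoeff0 (I : R -> Prop) p : homog_ideal I -> ~ I 1 -> I p -> p@_0%MM = 0.
Proof.
move=> [iI hI] I1 /(hI _ 0%N) Ip0; apply/eqP; rewrite mcoeff_eq0.
apply/negP => p0; apply: I1; apply: (subspaceZ_inv (c := p@_0%MM) (ideal_subspace iI)).
  by rewrite -mcoeff_msupp.
rewrite -mpolyX0; congr I: Ip0.
rewrite /hcomp big_mkcond (bigD1_seq 0%MM) ?msupp_uniq //= mdeg0 eqxx big1 ?addr0 // => m.
by rewrite mdeg_eq0 => /negPf->.
Qed.

Lemma regular_in_homog_ideal_size_le3 (I : R -> Prop) (fs : seq R) :
  homog_ideal I -> ~ I 1 -> regular fs -> (forall f, f \in fs -> I f) -> (size fs <= 3)%N.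
Proof.
by move=> hI I1 reg Ifs; apply: regular_size_le3 => // f /Ifs; apply: homog_ideal_mcoeff0.
Qed.

End KoszulDepth.

(** * Betti numbers and the Hilbert function *)

Section KoszulStrands.
Variable k : fieldType.
Local Notation R := {mpoly k[3]}.
Local Notation V3 := {ffun 'I_3 -> R}.
Implicit Types (i j d : nat) (p : R) (u v : V3).

(* The component of degree j of p as an element of the twist R(-i). *)
Definition twist_comp i j p : R := if (j < i)%N then 0 else pihomog mdeg (j - i) p.

Definition twist_compv i j v : V3 := [ffun t => twist_comp i j (v t)].

Lemma twist_comp_linear i j : linear (twist_comp i j).
Proof.
move=> c p q; rewrite /twist_comp; case: ifP => _; first by rewrite scaler0 addr0.
exact: linearP.
Qed.
HB.instance Definition _ i j := GRing.isLinear.Build k R R _ _ (twist_comp_linear i j).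

Lemma twist_compv_linear i j : linear (twist_compv i j).
Proof. by move=> c u v; apply/ffunP => t; rewrite !ffunE linearP. Qed.
HB.instance Definition _ i j := GRing.isLinear.Build k V3 V3 _ _ (twist_compv_linear i j).

Lemma twist_compvE i j v t : twist_compv i j v t = twist_comp i j (v t).
Proof. by rewrite ffunE. Qed.

Lemma twist_comp_idem i j p : twist_comp i j (twist_comp i j p) = twist_comp i j p.
Proof. by rewrite /twist_comp; case: (j < i)%N => //; apply: pihomog_id. Qed.

Lemma twist_compv_idem i j v : twist_compv i j (twist_compv i j v) = twist_compv i j v.
Proof. by apply/ffunP => t; rewrite !twist_compvE twist_comp_idem. Qed.

Lemma twist_comp_mulX i j (l : 'I_3) p :
  twist_comp i j ('X_l * p) = 'X_l * twist_comp i.+1 j p.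
Proof.
rewrite (mpolyE p) mulr_sumr !linear_sum mulr_sumr; apply: eq_bigr => m _ /=.
rewrite -scalerAr !linearZ -scalerAr -mpolyXD; congr (_ *: _) => /=.
rewrite /twist_comp !pihomogX /= mdegD mdeg1 mpolyXD.
case: ltnP => ji; case: ltnP => ji'; rewrite ?mulr0 //; try lia.
  by rewrite ifF //; lia.
by rewrite [RHS]fun_if mulr0; congr (if _ then _ else _); lia.
Qed.

Lemma hom_subspace d : is_subspace (fun p : R => hom d p).
Proof.
by split=> [|c p q hp hq]; [apply: dhomog0 | apply: rpredD => //; apply: rpredZ].
Qed.

Lemma twist_compP i j p : (i <= j)%N -> hom (j - i) p <-> twist_comp i j p = p.
Proof.
by move=> ij; rewrite /twist_comp ltnNge ij /hom homog_piE; split=> [/eqP|/eqP].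
Qed.

Lemma twist_compvP i j v : (i <= j)%N -> homv (j - i) v <-> twist_compv i j v = v.
Proof.
move=> ij; split=> [hv|Ev t]; last by apply/twist_compP; rewrite // -twist_compvE Ev.
by apply/ffunP => t; rewrite twist_compvE; apply/twist_compP.
Qed.

Lemma twist_comp_gt i j p : (j < i)%N -> twist_comp i j p = p -> p = 0.
Proof. by rewrite /twist_comp => ->. Qed.

Lemma twist_compv_gt i j v : (j < i)%N -> twist_compv i j v = v -> v = 0.
Proof.
by move=> ji Ev; apply/ffunP => t; rewrite [RHS]ffunE; apply: (twist_comp_gt ji);
  rewrite -twist_compvE Ev.
Qed.

Lemma twist_comp_kd1 j v : twist_comp 0 j (kd1 v) = kd1 (twist_compv 1 j v).
Proof.
rewrite !kd1E linear_sum; apply: eq_bigr => t _.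
by rewrite twist_compvE -twist_comp_mulX.
Qed.

Lemma twist_compv_kd2 j v : twist_compv 1 j (kd2 v) = kd2 (twist_compv 2 j v).
Proof.
by apply/ffunP; apply: ord3P; rewrite twist_compvE /kd2 /c0 /c1 /c2 !trE
  ?(raddfB, raddfD, raddfN) /= !twist_comp_mulX !twist_compvE.
Qed.

Lemma twist_compv_kd3 j p : twist_compv 2 j (kd3 p) = kd3 (twist_comp 3 j p).
Proof.
by apply/ffunP; apply: ord3P; rewrite twist_compvE /kd3 !trE ?raddfN /= !twist_comp_mulX.
Qed.

End KoszulStrands.

Section KoszulEuler.
Variable k : fieldType.
Local Notation R := {mpoly k[3]}.
Local Notation V3 := {ffun 'I_3 -> R}.
Variable J : R -> Prop.
Hypothesis homogJ : homog_ideal J.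
Let idealJ : is_ideal J := homogJ.1.
Let subJ : is_subspace J := ideal_subspace idealJ.
Let subJv : is_subspace (idealv J) := idealv_subspace idealJ.
Implicit Types (i j : nat).

Lemma twist_comp_ideal i j p : J p -> J (twist_comp i j p).
Proof. by rewrite /twist_comp; case: ifP => _ Jp; [case: subJ | apply: homogJ.2]. Qed.

Lemma twist_compv_ideal i j v : idealv J v -> idealv J (twist_compv i j v).
Proof. by move=> Jv t; rewrite twist_compvE; apply: twist_comp_ideal. Qed.

Definition twist_hilb (h : nat -> nat) i j : nat := if (j < i)%N then 0%N else h (j - i)%N.

Lemma twist_hilb_dim h i j :
  ((i <= j)%N -> hilb J (j - i) (h (j - i)%N)) ->
  dim_mod (fun p => twist_comp i j p = p) (strand (twist_comp i j) J) (twist_hilb h i j).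
Proof.
rewrite /twist_hilb; case: ltnP => [ji _|ij /(_ isT) dJ].
  apply: dim_mod0; last exact: subspace_strand.
  by move=> p Ep; split=> //; rewrite (twist_comp_gt ji Ep); case: subJ.
apply: (eq_dim_mod _ _ _ dJ) => [|p|p hp]; first exact: hom_subspace.
  exact: twist_compP.
by split=> [Jp|[]] //; split=> //; apply/twist_compP.
Qed.

Lemma twistv_hilb_dim h i j :
  ((i <= j)%N -> hilb J (j - i) (h (j - i)%N)) ->
  dim_mod (fun v => twist_compv i j v = v) (strand (twist_compv i j) (idealv J))
    (3 * twist_hilb h i j).
Proof.
move=> /twist_hilb_dim dh; have fixE (v : V3) :
    (forall t, twist_comp i j (v t) = v t) <-> twist_compv i j v = v.
  by split=> [Ev|Ev t]; [apply/ffunP => t; rewrite twist_compvE | rewrite -twist_compvE Ev].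
have sF : is_subspace (fun p : R => twist_comp i j p = p) by apply: subspace_fixed.
have sS : is_subspace (strand (twist_comp i j) J) by apply: subspace_strand.
have := dim_mod_ffun 'I_3 sF sS dh; rewrite card_ord; apply: eq_dim_mod => //.
  exact: (subspace_ffun _ sF).
move=> v Ev; split=> [Jv|[_ Jv] t]; last by split.
by split=> [|t]; [apply/fixE | case: (Jv t)].
Qed.

Definition boundaries0 j : R -> Prop := strand (twist_comp 0 j) (image_plus (@kd1 k) J).

Definition boundaries1 j : V3 -> Prop :=
  strand (twist_compv 1 j) (image_plus (@kd2 k) (idealv J)).

Definition boundaries2 j : V3 -> Prop :=
  strand (twist_compv 2 j) (image_plus (@kd3 k) (idealv J)).

Section Boundaries.
Variables (h : nat -> nat) (j : nat).
Hypothesis hilbJ : forall d, (d < j)%N -> hilb J d (h d).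

Let hilb_twist i : (0 < i)%N -> (i <= j)%N -> hilb J (j - i) (h (j - i)%N).
Proof. by move=> i0 ij; apply: hilbJ; lia. Qed.

Lemma dim_boundaries2 b :
  betti J 3 j b ->
  exists2 r, dim_mod (boundaries2 j) (strand (twist_compv 2 j) (idealv J)) r
    & twist_hilb h 3 j = (b + r)%N.
Proof.
move=> betti3; have sZ := subspace_preim (@kd3 k) subJv.
have sS : is_subspace (strand (twist_comp 3 j) J) by apply: subspace_strand.
have d3 : dim_mod (strand (twist_comp 3 j) (fun p => idealv J (kd3 p)))
    (strand (twist_comp 3 j) J) b.
  apply: dim_mod_strand betti3 => //; first by move=> j3 p; apply: twist_comp_gt.
  by rewrite -leqNgt => j3 p; apply: twist_compP.
rewrite -[b]addn0; apply: dim_mod_chain (twist_hilb_dim (@hilb_twist 3%N isT)) d3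
  (dim_mod0 _ sS) => //.
- exact: twist_compv_kd3.
- exact: twist_comp_idem.
- exact: twist_compv_ideal.
- by move=> p Jp; apply: kd3_ideal.
Qed.

Lemma dim_boundaries1 b r :
  betti J 2 j b -> dim_mod (boundaries2 j) (strand (twist_compv 2 j) (idealv J)) r ->
  exists2 s, dim_mod (boundaries1 j) (strand (twist_compv 1 j) (idealv J)) s
    & (3 * twist_hilb h 2 j = b + r + s)%N.
Proof.
move=> betti2 dr; have sZ := subspace_preim (@kd2 k) subJv.
have sB := subspace_image_plus (@kd3 k) subJv.
have d2 : dim_mod (strand (twist_compv 2 j) (fun v => idealv J (kd2 v)))
    (boundaries2 j) b.
  apply: dim_mod_strand betti2 => //; first by move=> j2 v; apply: twist_compv_gt.
  by rewrite -leqNgt => j2 v; apply: twist_compvP.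
apply: dim_mod_chain (twistv_hilb_dim (@hilb_twist 2%N isT)) d2 dr => //.
- exact: twist_compv_kd2.
- exact: twist_compv_idem.
- exact: twist_compv_ideal.
- by move=> v; apply: sub_image_plus.
- by move=> v [p Jp] /=; rewrite -[kd2 v]subr0 -(kd2_kd3 p) -raddfB; apply: kd2_ideal.
Qed.

Lemma dim_boundaries0 b r :
  betti J 1 j b -> dim_mod (boundaries1 j) (strand (twist_compv 1 j) (idealv J)) r ->
  exists2 s, dim_mod (boundaries0 j) (strand (twist_comp 0 j) J) s
    & (3 * twist_hilb h 1 j = b + r + s)%N.
Proof.
move=> betti1 dr; have sZ := subspace_preim (@kd1 k) subJ.
have sB := subspace_image_plus (@kd2 k) subJv.
have d1 : dim_mod (strand (twist_compv 1 j) (fun v => J (kd1 v)))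
    (boundaries1 j) b.
  apply: dim_mod_strand betti1 => //; first by move=> j1 v; apply: twist_compv_gt.
  by rewrite -leqNgt => j1 v; apply: twist_compvP.
apply: dim_mod_chain (twistv_hilb_dim (@hilb_twist 1%N isT)) d1 dr => //.
- exact: twist_comp_kd1.
- exact: twist_compv_idem.
- exact: twist_comp_ideal.
- by move=> v; apply: sub_image_plus.
- by move=> v [u Ju] /=; rewrite -[kd1 v]subr0 -(kd1_kd2 u) -raddfB; apply: kd1_ideal.
Qed.

End Boundaries.

Hypothesis J1 : ~ J 1.

Lemma image_plus_kd1_mcoeff0 p : image_plus (@kd1 k) J p <-> p@_0%MM = 0.
Proof.
split=> [[v /(homog_ideal_mcoeff0 homogJ J1)]|/mcoeff0_eq0P[v ->]].
  by rewrite mcoeffB mcoeff0_kd1 subr0.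
by exists v; rewrite subrr; case: subJ.
Qed.

Lemma codim_boundaries0 j :
  dim_mod (fun p => twist_comp 0 j p = p) (boundaries0 j) (j == 0%N).
Proof.
have sB : is_subspace (image_plus (@kd1 k) J) by apply: subspace_image_plus.
have [->|j0] := posnP j; last first.
  apply: dim_mod0; last exact: subspace_strand.
  move=> p Ep; split=> //; apply/image_plus_kd1_mcoeff0; apply/eqP.
  move/twist_compP: Ep => /(_ isT); rewrite subn0 => /dhomog_nemf_coeff hp.
  by rewrite hp //= mdeg0 ltn_eqF.
have sF : is_subspace (fun p : R => twist_comp 0 0 p = p) by apply: subspace_fixed.
have fix1 : twist_comp 0 0 (1 : R) = 1 by apply/twist_compP => //; apply: dhomog1.
rewrite -(card_ord true).
apply: (@basis_dim_mod _ _ _ _ _ (fun _ => 1)); first exact: subspace_strand.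
split=> [//|c|p Ep].
- rewrite big_ord1 => -[_ /image_plus_kd1_mcoeff0]; rewrite mcoeffZ mcoeff1 eqxx mulr1.
  by move=> c0 i; rewrite ord1.
- exists (fun _ => p@_0%MM); rewrite big_ord1; split.
    exact: (subspaceB sF Ep (subspaceZ _ sF fix1)).
  by apply/image_plus_kd1_mcoeff0; rewrite mcoeffB mcoeffZ mcoeff1 eqxx mulr1 subrr.
Qed.

Lemma koszul_euler (h : nat -> nat) j b1 b2 b3 :
  (forall d, (d < j)%N -> hilb J d (h d)) ->
  betti J 1 j b1 -> betti J 2 j b2 -> betti J 3 j b3 ->
  exists2 m, hilb J j m &
    (m + 3 * twist_hilb h 2 j + b1 + b3
     = (j == 0%N) + 3 * twist_hilb h 1 j + twist_hilb h 3 j + b2)%N.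
Proof.
move=> hilbJ betti1 betti2 betti3.
have [r2 d2 dimK3] := dim_boundaries2 hilbJ betti3.
have [r1 d1 dimK2] := dim_boundaries1 hilbJ betti2 d2.
have [r0 d0 dimK1] := dim_boundaries0 hilbJ betti1 d1.
exists ((j == 0%N) + r0)%N; last lia.
have dRJ : dim_mod (fun p => twist_comp 0 j p = p) (strand (twist_comp 0 j) J) ((j == 0%N) + r0).
  apply: dim_modD (codim_boundaries0 j) d0.
  - exact: subspace_strand.
  - exact/subspace_strand/subspace_image_plus.
  - by move=> p [Ep Jp]; split=> //; apply: sub_image_plus.
  - by move=> p [].
apply: eq_dim_mod dRJ => [|p|p Ep]; first exact: subspace_fixed.
  by rewrite -twist_compP ?subn0.
by split=> [[]|].
Qed.

End KoszulEuler.

(** * Monomial ideals *)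

Section Monomials.
Implicit Types (m u : 'X_{1..3}) (ms us : seq 'X_{1..3}).

Definition mnm3 (a b c : nat) : 'X_{1..3} := [multinom [tuple a; b; c]].

Lemma mnm3E a b c :
  (mnm3 a b c ord0 = a) * (mnm3 a b c (inord 1) = b) * (mnm3 a b c ord_max = c).
Proof. by rewrite !(mnm_nth 0) /= inordK. Qed.

Lemma mnm3_eta m : m = mnm3 (m ord0) (m (inord 1)) (m ord_max).
Proof. by apply/mnmP; apply: ord3P; rewrite mnm3E. Qed.

Lemma mnm3_ind (P : 'X_{1..3} -> Prop) : (forall a b c, P (mnm3 a b c)) -> forall m, P m.
Proof. by move=> P3 m; rewrite (mnm3_eta m). Qed.

Lemma mnm3_0 : mnm3 0 0 0 = 0%MM.
Proof. by apply/mnmP; apply: ord3P; rewrite mnm3E mnm0E. Qed.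

Lemma mnm3_U : (U_(ord0)%MM = mnm3 1 0 0) * (U_(inord 1)%MM = mnm3 0 1 0)
  * (U_(ord_max)%MM = mnm3 0 0 1).
Proof.
by split; first split; apply/mnmP; apply: ord3P; rewrite mnm3E mnm1E -val_eqE /= ?inordK.
Qed.

Lemma mnm3D a b c a' b' c' :
  (mnm3 a b c + mnm3 a' b' c')%MM = mnm3 (a + a') (b + b') (c + c').
Proof. by apply/mnmP; apply: ord3P; rewrite mnmDE !mnm3E. Qed.

Lemma mnm3B a b c a' b' c' :
  (mnm3 a b c - mnm3 a' b' c')%MM = mnm3 (a - a') (b - b') (c - c').
Proof. by apply/mnmP; apply: ord3P; rewrite mnmBE !mnm3E. Qed.

Lemma lem_mnm3 a b c a' b' c' :
  (mnm3 a b c <= mnm3 a' b' c')%MM = [&& a <= a', b <= b' & c <= c']%N.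
Proof.
apply/mnm_lepP/and3P => [le|[la lb lc]]; last by apply: ord3P; rewrite !mnm3E.
by have := (le ord0, le (inord 1), le ord_max); rewrite !mnm3E => -[[]].
Qed.

Lemma mdeg_mnm3 a b c : mdeg (mnm3 a b c) = (a + b + c)%N.
Proof. by rewrite mdegE big_ord3 !mnm3E. Qed.

Lemma mpolyX_mnm3 (k : fieldType) a b c :
  'X_[mnm3 a b c] = vx k ^+ a * vy k ^+ b * vz k ^+ c.
Proof. by rewrite mpolyXE_id big_ord3 !mnm3E. Qed.

Definition covers ms m : bool := has (fun u => (u <= m)%MM) ms.

Lemma covers_le ms m u : (m <= u)%MM -> covers ms m -> covers ms u.
Proof.
by move=> mu /hasP[w wms wm]; apply/hasP; exists w => //; apply: lepm_trans mu.
Qed.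

Lemma covers_sub ms us m : all (covers ms) us -> covers us m -> covers ms m.
Proof. by move=> /allP sub /hasP[u /sub cu um]; apply: covers_le cu. Qed.

Lemma covers_mem ms m : m \in ms -> covers ms m.
Proof. by move=> mms; apply/hasP; exists m; rewrite // lepm_refl. Qed.

Definition pure_powers a b c : seq 'X_{1..3} := [:: mnm3 a 0 0; mnm3 0 b 0; mnm3 0 0 c].

Lemma covers_pure_powers a b c m : (0 < a)%N -> (0 < b)%N -> (0 < c)%N ->
  covers (pure_powers a b c) m = ~~ (m <= mnm3 a.-1 b.-1 c.-1)%MM.
Proof.
by move=> a0 b0 c0; move: m; apply: mnm3_ind => u v w; rewrite /covers /= !lem_mnm3; lia.
Qed.

End Monomials.

Section MonomialIdeals.
Variable k : fieldType.
Local Notation R := {mpoly k[3]}.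
Implicit Types (f g p : R) (m u : 'X_{1..3}) (ms us : seq 'X_{1..3}).

Definition monomial_ideal ms f : Prop := forall m, m \in msupp f -> covers ms m.

Lemma monomial_idealX ms m : monomial_ideal ms 'X_[m] <-> covers ms m.
Proof.
by split=> [|cm u]; [apply; rewrite msuppX inE | rewrite msuppX inE => /eqP->].
Qed.

Lemma monomial_ideal1 ms : monomial_ideal ms 1 <-> covers ms 0%MM.
Proof. by rewrite -mpolyX0; apply: monomial_idealX. Qed.

Lemma monomial_ideal_is_ideal ms : is_ideal (monomial_ideal ms).
Proof.
split; first by move=> m; rewrite msupp0.
split=> [f g If Ig m /msuppD_le|f g Ig m /msuppM_le/allpairsP[[m1 m2] /= [_ m2g ->]]].
  by rewrite mem_cat => /orP[/If|/Ig].
by apply: covers_le (Ig _ m2g); apply: lem_addl.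
Qed.

Lemma monomial_ideal_homog ms : homog_ideal (monomial_ideal ms).
Proof.
split=> [|f d If]; first exact: monomial_ideal_is_ideal.
have iI := monomial_ideal_is_ideal ms.
rewrite /hcomp big_seq_cond; apply: ideal_sum => // m /andP[/If cm _].
by apply: (idealZ _ iI); apply/monomial_idealX.
Qed.

Lemma gen_monomials ms : gen [seq 'X_[m] | m <- ms] = monomial_ideal ms.
Proof.
apply: predext => f; split=> [|If].
  apply: gen_min; first exact: monomial_ideal_is_ideal.
  by move=> _ /mapP[m mms ->]; apply/monomial_idealX/covers_mem.
have iG := gen_is_ideal [seq 'X_[m] : R | m <- ms].
apply: (ideal_msupp iG) => m /If/hasP[u ums um].
by rewrite -(submK um) mpolyXD; apply: ideal_mull => //; apply/mem_gen/map_f.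
Qed.

Lemma monomial_ideal_mulX ms f u :
  monomial_ideal ms (f * 'X_[u]) <-> forall m, m \in msupp f -> covers ms (u + m).
Proof.
have E := perm_mem (msuppMX f u).
split=> [If m mf|cf m]; first by apply: If; rewrite E map_f.
by rewrite E => /mapP[m' m'f ->]; apply: cf.
Qed.

Lemma colon_monomial_ideal ms us f :
  colon (monomial_ideal ms) (monomial_ideal us) f <->
  forall m u, m \in msupp f -> covers us u -> covers ms (u + m).
Proof.
split=> [Cf m u mf /monomial_idealX/Cf/monomial_ideal_mulX|H h Ih]; first exact.
have iI := monomial_ideal_is_ideal ms.
rewrite (mpolyE h) mulr_sumr big_seq; apply: ideal_sum => // u /Ih cu.
rewrite -scalerAr; apply: (idealZ _ iI).
by apply/monomial_ideal_mulX => m mf; apply: H.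
Qed.

(* Linkage by (x^a, y^b, z^c) reflects the complement of the set of monomials of an ideal
   in the box of the monomials dividing x^(a-1) y^(b-1) z^(c-1). *)
Lemma colon_pure_powers a b c ms us : (0 < a)%N -> (0 < b)%N -> (0 < c)%N ->
  let top := mnm3 a.-1 b.-1 c.-1 in
  all (covers ms) (pure_powers a b c) ->
  (forall m, (m <= top)%MM -> covers ms m = ~~ covers us (top - m)) ->
  eqI (monomial_ideal ms) (colon (monomial_ideal (pure_powers a b c)) (monomial_ideal us)).
Proof.
move=> a0 b0 c0 top powers_ms ms_us f; rewrite colon_monomial_ideal.
split=> [If m u /If cm cu|H m mf].
  rewrite covers_pure_powers //; apply: contraL cm => top_um.
  have m_top : (m <= top)%MM by apply: lepm_trans top_um; apply: lem_addl.
  rewrite ms_us // negbK; apply: covers_le cu.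
  by rewrite -(addmK m u) -/top; apply/mnm_lepP => i; rewrite !mnmBE leq_sub2r //
     (mnm_lepP top_um).
have [m_top|] := boolP (m <= top)%MM; last first.
  by rewrite -covers_pure_powers //; apply: covers_sub.
rewrite ms_us //; apply/negP => /(H _ _ mf).
by rewrite covers_pure_powers // submK // lepm_refl.
Qed.

Lemma regular_pure_powers a b c : (0 < a)%N -> (0 < b)%N -> (0 < c)%N ->
  regular [seq 'X_[m] : R | m <- pure_powers a b c].
Proof.
move=> a0 b0 c0; split.
  rewrite gen_monomials monomial_ideal1 covers_pure_powers //.
  by move/negP; apply; apply/mnm_lepP => i; rewrite mnm0E.
move=> i lti g; rewrite -map_take !gen_monomials mulrC (nth_map 0%MM) //.
move=> /monomial_ideal_mulX H m /H; move: m {H}; apply: mnm3_ind => u v w.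
case: i lti => [|[|[|i]]] //= _; rewrite /covers /= !mnm3D !lem_mnm3; lia.
Qed.

Lemma grade_monomial_ideal a b c ms :
  all (covers ms) (pure_powers a b c) -> ~~ covers ms 0%MM -> grade (monomial_ideal ms) 3.
Proof.
move=> powers_ms c0; have n1 : ~ monomial_ideal ms 1 by rewrite monomial_ideal1; apply/negP.
split=> //; split=> [|fs]; last first.
  by apply: regular_in_homog_ideal_size_le3 => //; apply: monomial_ideal_homog.
exists [seq 'X_[m] | m <- pure_powers a b c]; split=> //; split.
  by apply: regular_pure_powers; rewrite lt0n; apply: contraNneq c0 => E; move: powers_ms;
    rewrite /= E mnm3_0 => /and4P[].
by move=> _ /mapP[m mb ->]; apply/monomial_idealX/(allP powers_ms).
Qed.

Lemma ci_type_pure_powers a b c : ci_type [seq 'X_[m] : R | m <- pure_powers a b c] = [:: a; b; c].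
Proof. by rewrite /ci_type /= /pdeg !msizeX !mdeg_mnm3 !addn0 !add0n. Qed.

Lemma hci_pure_powers a b c : (0 < a)%N -> (a <= b)%N -> (b <= c)%N ->
  hci [seq 'X_[m] : R | m <- pure_powers a b c] 3.
Proof.
move=> a0 ab bc; split=> //; split; first by apply: regular_pure_powers => //; lia.
split; last by rewrite -/(ci_type _) ci_type_pure_powers /= ab bc.
by move=> _ /mapP[m _ ->]; apply/homogP; exists (mdeg m); rewrite dhomogX.
Qed.

Lemma linked_pure_powers a b c ms us :
  (0 < a)%N -> (a <= b)%N -> (b <= c)%N ->
  let top := mnm3 a.-1 b.-1 c.-1 in
  all (covers ms) (pure_powers a b c) -> all (covers us) (pure_powers a b c) ->
  ~~ covers ms 0%MM -> ~~ covers us 0%MM ->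
  (forall m, (m <= top)%MM -> covers ms m = ~~ covers us (top - m)) ->
  linked (monomial_ideal ms) (monomial_ideal us) [seq 'X_[m] | m <- pure_powers a b c] 3.
Proof.
move=> a0 ab bc top powers_ms powers_us ms0 us0 ms_us.
have [b0 c0] : (0 < b)%N /\ (0 < c)%N by lia.
have us_ms m : (m <= top)%MM -> covers us m = ~~ covers ms (top - m).
  by move=> m_top; rewrite ms_us ?lem_subr // negbK submBA // addmC addmK.
split; first exact: monomial_ideal_homog.
split; first exact: monomial_ideal_homog.
split; first exact: (grade_monomial_ideal powers_ms ms0).
split; first exact: (grade_monomial_ideal powers_us us0).
split; first exact: hci_pure_powers.
by rewrite gen_monomials; split; apply: colon_pure_powers.
Qed.

Lemma betti3_socle (I : R -> Prop) d w h :
  is_ideal I -> hilb I d h -> hom d w -> idealv I (kd3 w) -> ~ I w ->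
  exists2 b, (0 < b)%N & betti I 3 (d + 3) b.
Proof.
move=> iI [_ maxh] hw Iw nIw; have sI := ideal_subspace iI.
pose Z p := hom d p /\ idealv I (kd3 p); pose B p := hom d p /\ I p.
have sH : is_subspace (fun p : R => hom d p) by apply: hom_subspace.
have [b db] : exists b, dim_mod Z B b.
  apply: (@dim_mod_exists _ _ _ _ h) => l s [Zs inds].
  apply: (maxh _ s); split=> [i|c Ic]; first exact: (Zs i).1.
  by apply: inds; split=> //; exact: (subspace_comb c sH (fun i => (Zs i).1)).
exists b; first by apply: (dim_mod_gt0 (v := w) _ _ _ db); [exact: subspaceI | split | case].
by rewrite /betti ltnNge leq_addl addnK.
Qed.

Lemma perfect_monomial_ideal a b c ms m h :
  all (covers ms) (pure_powers a b c) -> ~~ covers ms m -> (forall i, covers ms (U_(i) + m)) ->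
  hilb (monomial_ideal ms) (mdeg m) h -> perfect (monomial_ideal ms).
Proof.
move=> powers_ms ncm socle dh; split; first exact: monomial_ideal_homog.
exists 3%N; split.
  apply: grade_monomial_ideal powers_ms _; apply: contra ncm; apply: covers_le.
  by apply/mnm_lepP => i; rewrite mnm0E.
split; last by move=> [|[|[|[|i]]]] // j _; rewrite /betti; case: ifP.
have iI := monomial_ideal_is_ideal ms.
have IX i : monomial_ideal ms ('X_i * 'X_[m]) by rewrite -mpolyXD; apply/monomial_idealX.
have [|||l l0 bl] := betti3_socle iI dh (w := 'X_[m]); last by exists (mdeg m + 3)%N, l.
- by rewrite /hom dhomogX.
- apply: idealv_tr; try exact: IX.
  exact: (subspaceN (ideal_subspace iI) (IX _)).
- by move/monomial_idealX; apply/negP.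
Qed.

Lemma hilb_monomial_ideal ms s d :
  (forall m, count_mem m s = ~~ covers ms m) ->
  hilb (monomial_ideal ms) d (count (fun m => mdeg m == d) s).
Proof.
move=> countE; rewrite -size_filter; set t := filter _ _.
have s_mem m : (m \in s) = ~~ covers ms m by rewrite -has_pred1 has_count countE lt0b.
have t_uniq : uniq t.
  by apply/filter_uniq/count_mem_uniq => m; rewrite countE s_mem.
pose e (i : 'I_(size t)) := nth 0%MM t i.
have coefE (c : 'I_(size t) -> k) i : (\sum_j c j *: ('X_[e j] : R))@_(e i) = c i.
  rewrite raddf_sum (bigD1 i) //= mcoeffZ mcoeffX eqxx mulr1 big1 ?addr0 // => j /negPf ji.
  by rewrite mcoeffZ mcoeffX nth_uniq // (_ : (j == i :> nat) = false) ?mulr0.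
have sI := ideal_subspace (monomial_ideal_is_ideal ms).
rewrite -[size t]card_ord; apply: (basis_dim_mod (s := fun i => 'X_[e i]) sI).
split=> [i|c Ic i|p hp].
- have := mem_nth 0%MM (ltn_ord i); rewrite mem_filter => /andP[/eqP di _].
  by rewrite /hom dhomogX /= di.
- apply: contraTeq (mem_nth 0%MM (ltn_ord i)) => ci; rewrite mem_filter s_mem.
  by rewrite (Ic (e i)) ?andbF // mcoeff_msupp coefE.
exists (fun i => p@_(e i)) => m; rewrite mcoeff_msupp; apply: contraNT => ncm.
rewrite mcoeffB subr_eq0; have [pm|pm] := boolP (m \in msupp p); last first.
  rewrite (memN_msupp_eq0 pm) raddf_sum big1 //= => i _; rewrite mcoeffZ mcoeffX.
  by case: eqP => [->|_]; rewrite ?mulr0 // (memN_msupp_eq0 pm) mul0r.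
have mt : m \in t.
  by rewrite mem_filter s_mem ncm andbT; apply/eqP; move/dhomogP: hp; apply.
have := coefE (fun i => p@_(e i)) (Ordinal (etrans (index_mem m t) mt)).
by rewrite /e /= nth_index // => ->.
Qed.

End MonomialIdeals.

(** * Generating functions of boxes of monomials *)

Definition mnm_box (a b c : nat * nat) : seq 'X_{1..3} :=
  [seq mnm3 x.1.1 x.1.2 x.2
     | x <- [seq (uv, w) | uv <- [seq (u, v) | u <- index_iota a.1 a.2, v <- index_iota b.1 b.2],
                           w <- index_iota c.1 c.2]].

Lemma mnm3_inj : injective (fun x : nat * nat * nat => mnm3 x.1.1 x.1.2 x.2).
Proof.
move=> [[u v] w] [[u' v'] w'] /= E.
by have := (mnm3E u v w, mnm3E u' v' w'); rewrite E => -[[[-> ->] ->]] [[-> ->] ->].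
Qed.

Lemma count_mem_mnm_box a b c u v w :
  count_mem (mnm3 u v w) (mnm_box a b c)
  = [&& a.1 <= u < a.2, b.1 <= v < b.2 & c.1 <= w < c.2]%N.
Proof.
have mem_pair (S T : eqType) (s : seq S) (t : seq T) x y :
    ((x, y) \in [seq (x', y') | x' <- s, y' <- t]) = (x \in s) && (y \in t).
  apply/allpairsP/andP => [[[x' y'] /= [xs yt [-> ->]]] //|[xs yt]].
  by exists (x, y).
have uniq_pair (S T : eqType) (s : seq S) (t : seq T) :
    uniq s -> uniq t -> uniq [seq (x, y) | x <- s, y <- t].
  by move=> us ut; apply: allpairs_uniq => // -[x y] [x' y'].
rewrite count_uniq_mem; last by rewrite map_inj_uniq ?uniq_pair ?iota_uniq //; apply: mnm3_inj.
by rewrite (mem_map mnm3_inj _ (u, v, w)) !mem_pair !mem_index_iota -andbA.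
Qed.

Definition mdeg_gf (s : seq 'X_{1..3}) : {poly int} := \sum_(m <- s) 'X^(mdeg m).

Lemma coef_mdeg_gf s d : (mdeg_gf s)`_d = (count (fun m => mdeg m == d) s)%:R.
Proof.
rewrite /mdeg_gf coef_sum -sum1_count natr_sum [RHS]big_mkcond.
by apply: eq_bigr => m _; rewrite coefXn eq_sym; case: eqP.
Qed.

Lemma mdeg_gf_cat s t : mdeg_gf (s ++ t) = mdeg_gf s + mdeg_gf t.
Proof. exact: big_cat. Qed.

Lemma geometric_sum (R : nzRingType) (x : R) p q : (p <= q)%N ->
  (1 - x) * (\sum_(p <= i < q) x ^+ i) = x ^+ p - x ^+ q.
Proof.
move=> pq; rewrite mulr_sumr -[RHS]opprB -telescope_sumr // -sumrN.
by apply: eq_bigr => i _; rewrite mulrBl mul1r exprS opprB.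
Qed.

Lemma mdeg_gf_mnm_box a b c :
  (a.1 <= a.2)%N -> (b.1 <= b.2)%N -> (c.1 <= c.2)%N ->
  (1 - 'X) ^+ 3 * mdeg_gf (mnm_box a b c)
  = ('X^(a.1) - 'X^(a.2)) * ('X^(b.1) - 'X^(b.2)) * ('X^(c.1) - 'X^(c.2)).
Proof.
move=> a12 b12 c12; rewrite -!geometric_sum //.
suff -> : mdeg_gf (mnm_box a b c) = (\sum_(a.1 <= u < a.2) 'X^u) *
    (\sum_(b.1 <= v < b.2) 'X^v) * (\sum_(c.1 <= w < c.2) 'X^w) by ring.
rewrite /mdeg_gf big_map !big_allpairs -!mulrA mulr_suml; apply: eq_bigr => u _.
rewrite mulrCA mulr_suml mulr_sumr; apply: eq_bigr => v _.
by rewrite !mulr_sumr; apply: eq_bigr => w _; rewrite mdeg_mnm3 !exprD; ring.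
Qed.

(** * The ideal J' *)

Definition Jprime_mnms n : seq 'X_{1..3} :=
  [:: mnm3 2 0 0; mnm3 0 (2 * n + 1) 0; mnm3 0 0 (2 * n + 4); mnm3 0 n 1;
      mnm3 1 (n - 1) 1; mnm3 1 1 (n + 1)].

Lemma gen_Jprime (k : fieldType) n :
  gen (Jprime_gens k n) = monomial_ideal (Jprime_mnms n).
Proof.
by rewrite -gen_monomials /= !mpolyX_mnm3 !expr0 !expr1 !mulr1 !mul1r.
Qed.

(* The last ideal of the chain, with index 4, is the default value of [nth]. *)
Definition link_mnms n i : seq 'X_{1..3} :=
  nth (pure_powers 1 (n - 2) n)
   [:: Jprime_mnms n;
    [:: mnm3 2 0 0; mnm3 1 (n + 1) 0; mnm3 0 (2 * n) 0; mnm3 0 (n + 2) (n + 3);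
        mnm3 0 0 (2 * n + 3)];
    [:: mnm3 2 0 0; mnm3 1 (n - 2) 0; mnm3 1 0 n; mnm3 0 (n - 1) 0; mnm3 0 0 (2 * n + 3)];
    [:: mnm3 1 0 0; mnm3 0 (n - 1) 0; mnm3 0 1 (n + 3); mnm3 0 0 (2 * n + 3)]] i.

Definition link_powers n i : seq 'X_{1..3} :=
  nth [::] [:: pure_powers 2 (2 * n + 1) (2 * n + 4); pure_powers 2 (2 * n) (2 * n + 3);
               pure_powers 2 (n - 1) (2 * n + 3); pure_powers 1 (n - 1) (2 * n + 3)] i.

Lemma link_mnms_linked (k : fieldType) n i : (4 <= n)%N -> (i < 4)%N ->
  linked (monomial_ideal (link_mnms n i)) (monomial_ideal (link_mnms n i.+1))
    [seq 'X_[m] : {mpoly k[3]} | m <- link_powers n i] 3.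
Proof.
move=> n4; case: i => [|[|[|[|//]]]] _; apply: linked_pure_powers;
  first [ by apply: mnm3_ind => u v w; rewrite /covers /= mnm3B !lem_mnm3 !leq0n /= !andbT ?orbF;
    lia
  | by rewrite /covers /= -?mnm3_0 ?lem_mnm3; lia ].
Qed.

Definition Jprime_std n : seq 'X_{1..3} :=
  (mnm_box (0, 1) (0, n) (0, 2 * n + 4)
  ++ mnm_box (0, 1) (n, 2 * n + 1) (0, 1)
  ++ mnm_box (1, 2) (0, 1) (0, 2 * n + 4)
  ++ mnm_box (1, 2) (1, n - 1) (0, n + 1)
  ++ mnm_box (1, 2) (n - 1, 2 * n + 1) (0, 1))%N.

Lemma count_mem_Jprime_std n m : (4 <= n)%N ->
  count_mem m (Jprime_std n) = ~~ covers (Jprime_mnms n) m.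
Proof.
move=> n4; move: m; apply: mnm3_ind => u v w.
by rewrite !count_cat !count_mem_mnm_box /covers /= !lem_mnm3; lia.
Qed.

Definition Jprime_hilb n d : nat := count (fun m => mdeg m == d) (Jprime_std n).

Lemma hilb_Jprime (k : fieldType) n d : (4 <= n)%N ->
  hilb (gen (Jprime_gens k n)) d (Jprime_hilb n d).
Proof.
by move=> n4; rewrite gen_Jprime; apply: hilb_monomial_ideal => m; apply: count_mem_Jprime_std.
Qed.

Lemma mdeg_gf_Jprime_std n : (4 <= n)%N ->
  (1 - 'X) ^+ 3 * mdeg_gf (Jprime_std n) =
    1 - 'X^2 - 2 * 'X^(n + 1) - 'X^(n + 3) - 'X^(2 * n + 4)
    + 2 * 'X^(n + 2) + 'X^(n + 4) + 'X^(2 * n + 3) + 2 * 'X^(2 * n + 6) + 'X^(3 * n + 4)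
    - 'X^(2 * n + 4) - 'X^(2 * n + 7) - 'X^(3 * n + 5).
Proof.
move=> n4; rewrite !mdeg_gf_cat !mulrDr !mdeg_gf_mnm_box /=; try lia.
have [m ->] : exists m, n = m.+1 by exists n.-1; lia.
by rewrite subn1 /= !mulnS !exprD !(exprS _ m); ring.
Qed.

(* The socle of R/J' contains the class of x y^(2n). *)
Lemma perfect_Jprime (k : fieldType) n : (4 <= n)%N -> perfect (gen (Jprime_gens k n)).
Proof.
move=> n4; have := hilb_Jprime k (2 * n + 1) n4; rewrite gen_Jprime.
have <- : mdeg (mnm3 1 (2 * n) 0) = (2 * n + 1)%N by rewrite mdeg_mnm3; lia.
apply: (@perfect_monomial_ideal _ 2 (2 * n + 1) (2 * n + 4)).
- by rewrite /covers /= !lem_mnm3; lia.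
- by rewrite /covers /= !lem_mnm3; lia.
by apply: ord3P; rewrite mnm3_U mnm3D /covers /= !lem_mnm3; lia.
Qed.

Lemma SBL_Jprime (k : fieldType) n : (4 <= n)%N -> SBL (gen (Jprime_gens k n)).
Proof.
move=> n4; split; first exact: perfect_Jprime.
exists 3%N, 4%N, (fun i => monomial_ideal (link_mnms n i)).
exists (fun i => [seq 'X_[m] | m <- link_powers n i]).
split; first by rewrite gen_Jprime.
split; first by move=> i; apply: link_mnms_linked.
split.
  exists [seq 'X_[m] | m <- pure_powers 1 (n - 2) n]; rewrite gen_monomials; split=> //.
  by apply: hci_pure_powers; lia.
by move=> [|[|[|i]]] // _ [|[|[|l]]] // _; rewrite !ci_type_pure_powers /=; lia.
Qed.

Lemma betti_tableE n j : (4 <= n)%N ->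
  [/\ betti_table n 1 j
        = ((j == 2) + 2 * (j == n + 1) + (j == n + 3) + (j == 2 * n + 4))%N,
      betti_table n 2 j
        = (2 * (j == n + 2) + (j == n + 4) + (j == 2 * n + 3) + 2 * (j == 2 * n + 6)
           + (j == 3 * n + 4))%N
    & betti_table n 3 j
        = ((j == 2 * n + 4) + (j == 2 * n + 7) + (j == 3 * n + 5))%N].
Proof. by move=> n4; split; rewrite /betti_table; do ![case: eqP => ?]; lia. Qed.

Lemma Jprime_hilb_rec n j : (4 <= n)%N ->
  (Jprime_hilb n j + 3 * twist_hilb (Jprime_hilb n) 2 j + betti_table n 1 j + betti_table n 3 j
   = (j == 0) + 3 * twist_hilb (Jprime_hilb n) 1 j + twist_hilb (Jprime_hilb n) 3 j
     + betti_table n 2 j)%N.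
Proof.
move=> n4; have [-> -> ->] := betti_tableE j n4; set p := mdeg_gf (Jprime_std n).
have shiftE i : ('X^i * p)`_j = twist_hilb (Jprime_hilb n) i j :> int.
  by rewrite coefXnM /twist_hilb; case: ifP => // _; rewrite coef_mdeg_gf natz.
have := congr1 (fun q : {poly int} => q`_j) (mdeg_gf_Jprime_std n4).
have -> : (1 - 'X) ^+ 3 * p = 'X^0 * p - ('X^1 * p) *+ 3 + ('X^2 * p) *+ 3 - 'X^3 * p.
  by ring.
rewrite !mulr_natl -[1]/('X^0 : {poly int}).
rewrite !(coefD, coefN, coefMn) !shiftE !coefXn !natz /twist_hilb ltn0 subn0.
lia.
Qed.

Lemma hilb_of_betti (k : fieldType) n (J : {mpoly k[3]} -> Prop) d : (4 <= n)%N ->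
  homog_ideal J -> ~ J 1 ->
  (forall i j, (1 <= i)%N -> betti J i j (betti_table n i j)) ->
  hilb J d (Jprime_hilb n d).
Proof.
move=> n4 homogJ J1 bettiJ; elim/ltn_ind: d => j IH.
have [m dm E] := koszul_euler homogJ J1 IH (bettiJ 1%N j isT) (bettiJ 2%N j isT)
  (bettiJ 3%N j isT).
by have -> : Jprime_hilb n j = m by have := Jprime_hilb_rec j n4; lia.
Qed.

Theorem theorem5p4 (k : fieldType) (n : nat) (J : {mpoly k[3]} -> Prop) :
  (4 <= n)%N ->
  homog_ideal J ->
  grade J 3 ->
  (forall i j, (1 <= i)%N -> betti J i j (betti_table n i j)) ->
  SBL (gen (Jprime_gens k n)) /\
  (forall d m, hilb (gen (Jprime_gens k n)) d m <-> hilb J d m).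
Proof.
move=> n4 homogJ [J1 _] bettiJ; split; first exact: SBL_Jprime.
move=> d m; have hJ := hilb_of_betti d n4 homogJ J1 bettiJ.
have hJ' := hilb_Jprime k d n4.
by split=> [/(dim_mod_unique hJ') <- | /(dim_mod_unique hJ) <-].
Qed.
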